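(* Let $\mathcal{H}$ be a Hilbert space, $d\in\mathbb{N}$, $\mathcal{B}\subseteq\mathcal{B}(\mathcal{H})$ a unital $\dagger$-algebra of bounded operators, and let $\lambda_\nu^\mu:\mathcal{B}\to\mathcal{B}$ ($\mu\in\{-,1,\dots,d\}$, $\nu\in\{+,1,\dots,d\}$) be linear maps with the $\flat$-property. Suppose that the quantum stochastic equation $$\mathrm{d}\phi_t(B)=\sum_{\mu,\nu}\phi_t\big(\lambda_\nu^\mu(B)\big)\,\mathrm{d}\Lambda_\mu^\nu,\qquad \phi_0(B)=B,\qquad B\in\mathcal{B},$$ has a completely positive (CP) solution $\phi_t$, $t>0$. Define the germ-map $\boldsymbol{\gamma}=(\lambda_\nu^\mu+\delta_\nu^\mu)_{\nu=+,\bullet}^{\mu=-,\bullet}$ and the degenerate representation $\boldsymbol{\iota}$ of $\mathcal{B}$, written as operator block matrices on $\mathcal{H}\oplus\mathcal{H}^\bullet$, $\mathcal{H}^\bullet=\mathcal{H}\otimes\mathbb{C}^d$: $$\boldsymbol{\gamma}(B)=\begin{pmatrix}\gamma(B)&\gamma_\bullet(B)\\ \gamma^\bullet(B)&\gamma_\bullet^\bullet(B)\end{pmatrix},\qquad \boldsymbol{\iota}(B)=\begin{pmatrix}B&0\\0&0\end{pmatrix},$$ where $\gamma=\lambda_+^-$, $\gamma^m=\lambda_+^m$, $\gamma_n=\lambda_n^-$, $\gamma_n^m(B)=\lambda_n^m(B)+B\delta_n^m$ ($m,n=1,\dots,d$), $\gamma_\bullet=(\gamma_n)$, $\gamma^\bullet=(\gamma^m)$,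 $\gamma_\bullet^\bullet=(\gamma_n^m)$, so that $$\gamma(B^\dagger)=\gamma(B)^\dagger,\qquad \gamma^n(B^\dagger)=\gamma_n(B)^\dagger,\qquad \gamma_n^m(B^\dagger)=\gamma_m^n(B)^\dagger .$$ Then $\boldsymbol{\gamma}$ is conditionally completely positive with respect to $\boldsymbol{\iota}$: for every finite sequence $B_k\in\mathcal{B}$ and $\boldsymbol{\eta}_k\in\mathcal{H}\oplus\mathcal{H}^\bullet$, $$\sum_k\boldsymbol{\iota}(B_k)\boldsymbol{\eta}_k=0\ \Longrightarrow\ \sum_{k,l}\langle\boldsymbol{\eta}_k|\boldsymbol{\gamma}(B_k^\dagger B_l)\boldsymbol{\eta}_l\rangle\ge 0 .$$
   Context: Inner products are linear in the second argument; $\dagger$ is the Hilbert-space adjoint; $\mathbb{R}_+=[0,\infty)$. Quantum noise. $\mathcal{F}$ is the (symmetric) Fock space over $\mathbb{C}^d\otimes L^2(\mathbb{R}_+)$. For $f^\bullet=(f^1,\dots,f^d)\in\mathbb{C}^d\otimes L^2(\mathbb{R}_+)$, $f^\otimes\in\mathcal{F}$ is the exponential (coherent) vector $f^\otimes(\tau)=\bigotimes_{t\in\tau}f^\bullet(t)$ for finite $\tau\subset\mathbb{R}_+$, so $\langle f^\otimes|h^\otimes\rangle=\exp\int_0^\infty f^\bullet(s)^\dagger h^\bullet(s)\,\mathrm{d}s$, where $f^\bullet(s)^\dagger h^\bullet(s)=\sum_n \overline{f^n(s)}h^n(s)$. $\mathcal{D}\subset\mathcal{H}\otimes\mathcal{F}$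 is the linear span of the vectors $\xi\otimes f^\otimes$, $\xi\in\mathcal{H}$. The integrators $\Lambda_\mu^\nu(t)$, $\mu\in\{-,1,\dots,d\}$, $\nu\in\{+,1,\dots,d\}$, are the standard Hudson–Parthasarathy processes: time $\Lambda_-^+(t)=tI$, annihilation $\Lambda_-^n(t)$, creation $\Lambda_m^+(t)$, exchange-number $\Lambda_m^n(t)$, with Itô table $\mathrm{d}\Lambda_\mu^\beta\,\mathrm{d}\Lambda_\gamma^\nu=\delta_\gamma^\beta\,\mathrm{d}\Lambda_\mu^\nu$. Solutions. The $\phi_t$ are linear maps from $\mathcal{B}$ into sesquilinear forms on $\mathcal{D}$, adapted: the $\mathcal{H}$-form $\phi_t(f^\bullet,B,h^\bullet)$ given by $$\langle\eta|\phi_t(f^\bullet,B,h^\bullet)\eta'\rangle=\langle\eta\otimes f^\otimes|\phi_t(B)\,\eta'\otimes h^\otimes\rangle\, e^{-\int_t^\infty f^\bullet(s)^\dagger h^\bullet(s)\,\mathrm{d}s}$$ depends on $f^\bullet,h^\bullet$ only through their restrictions to $[0,t)$. The quantum stochastic equation with $\phi_0(B)=B$ means (in the integrated sense in $t$) $\phi_0(f^\bullet,B,h^\bullet)=B$ and $$\frac{\mathrm{d}}{\mathrm{d}t}\phi_t(f^\bullet,B,h^\bullet)=f^\bullet(t)^\dagger h^\bullet(t)\,\phi_t(f^\bullet,B,h^\bullet)+\phi_t(f^\bullet,\lambda_+^-(B),h^\bullet)+\sum_m\overline{f^m(t)}\,\phi_t(f^\bullet,\lambda_+^m(B),h^\bullet)+\sum_n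 h^n(t)\,\phi_t(f^\bullet,\lambda_n^-(B),h^\bullet)+\sum_{m,n}\overline{f^m(t)}h^n(t)\,\phi_t(f^\bullet,\lambda_n^m(B),h^\bullet).$$ Complete positivity of $\phi_t$: for every family $\xi_B^f\in\mathcal{H}$, nonzero for only finitely many $B\in\mathcal{B}$ and finitely many $f^\bullet$, $$\sum_{X,Z}\sum_{f,h}\langle\xi_X^f|\phi_t(f^\bullet,X^\dagger Z,h^\bullet)\xi_Z^h\rangle\ge0 .$$ $\flat$-property: $\lambda_+^-(B^\dagger)=\lambda_+^-(B)^\dagger$, $\lambda_+^n(B^\dagger)=\lambda_n^-(B)^\dagger$, $\lambda_n^m(B^\dagger)=\lambda_m^n(B)^\dagger$ for all $B\in\mathcal{B}$. Also $\delta_\nu^\mu(B)=B\delta_\nu^\mu$ (Kronecker delta; in particular $\delta_+^-=\delta_n^-=\delta_+^m=0$). *)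

(* Defs.v *)
From HB Require Import structures.
From mathcomp Require Import all_boot all_order all_algebra sesquilinear.
From mathcomp Require Import complex.
From mathcomp Require Import all_classical all_reals all_analysis.

Set Implicit Arguments.
Unset Strict Implicit.
Unset Printing Implicit Defensive.

Import Order.TTheory GRing.Theory Num.Theory.
Import numFieldNormedType.Exports.

Local Open Scope classical_set_scope.
Local Open Scope complex_scope.
Local Open Scope ring_scope.

Section ComplexAnalysis.
Variable R : realType.
Notation mu := (@lebesgue_measure R).

Definition cexp (z : R[i]) : R[i] :=
  (expR (complex.Re z))%:C * (cos (complex.Im z) +i* sin (complex.Im z)).

Definition cintegrable (A : set R) (F : R -> R[i]) : Prop :=
  mu.-integrable A (fun t => (complex.Re (F t))%:E) /\
  mu.-integrable A (fun t => (complex.Im (F t))%:E).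

Definition cintegral (A : set R) (F : R -> R[i]) : R[i] :=
  (\int[mu]_(t in A) complex.Re (F t)) +i* (\int[mu]_(t in A) complex.Im (F t)).

Variable d : nat.

(* [f t n] is the value f^n(t).  Elements of C^d (x) L^2(R_+) are represented
   by functions on R satisfying [noiseL2]; values at negative times are
   irrelevant. *)
Definition noise := R -> 'I_d -> R[i].
HB.instance Definition _ := Choice.on noise.

Definition noiseL2 (f : noise) : Prop := forall n : 'I_d,
  [/\ measurable_fun (`[0, +oo[ : set R) (fun t : R => complex.Re (f t n)),
      measurable_fun (`[0, +oo[ : set R) (fun t : R => complex.Im (f t n)) &
      mu.-integrable `[0, +oo[
        (fun t => (complex.Re (f t n) ^+ 2 + complex.Im (f t n) ^+ 2)%:E)].

Definition noise_dot (f h : noise) (t : R) : R[i] :=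
  \sum_(n < d) (f t n)^* * h t n.

(* Equality of the restrictions to [0, t) as classes in L^2. *)
Definition eq_before (t : R) (f f' : noise) : Prop :=
  {ae mu, forall s, 0 <= s < t -> f s = f' s}.

End ComplexAnalysis.

Section Operators.
Variables (R : realType) (H : completeNormedModType R[i]).
(* MathComp's {dot _ for _} are linear in the FIRST argument: the scalar
   product <x|y>, linear in y, is [ip y x]. *)
Variable ip : {dot H for Num.conj}.

Definition hilbert_product : Prop := forall x : H, `|x| ^+ 2 = ip x x.

Definition bounded_operator (X : H -> H) : Prop :=
  linear X /\ exists M : R[i], forall x, `|X x| <= M * `|x|.

Definition is_adjoint (X Y : H -> H) : Prop :=
  forall x y, ip (X y) x = ip y (Y x).

(* The adjoint is unique, and it exists if [X] is bounded. *)
Definition adjoint (X : H -> H) : H -> H := xget 0 [set Y | is_adjoint X Y].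

Record unital_dagger_algebra (B : set (H -> H)) : Prop := {
  uda_bounded : forall X, B X -> bounded_operator X;
  uda_one : B id;
  uda_add : forall X Y, B X -> B Y -> B (X + Y);
  uda_scale : forall (a : R[i]) X, B X -> B (a *: X);
  uda_comp : forall X Y, B X -> B Y -> B (X \o Y);
  uda_adjoint : forall X, B X -> exists2 Y, B Y & is_adjoint X Y }.

Variable d : nat.

(* [lam mu nu] is lambda^mu_nu: the upper index mu ranges over {-,1,...,d} and
   the lower index nu over {+,1,...,d}; [None] is - as an upper index and + as
   a lower one. *)
Notation germ_family := (option 'I_d -> option 'I_d -> (H -> H) -> (H -> H)).

Definition linear_maps_on (B : set (H -> H)) (lam : germ_family) : Prop :=
  forall mu nu,
    (forall X, B X -> B (lam mu nu X)) /\
    (forall (a : R[i]) X Y, B X -> B Y ->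
       lam mu nu (a *: X + Y) = a *: lam mu nu X + lam mu nu Y).

Definition flat_property (B : set (H -> H)) (lam : germ_family) : Prop :=
  forall X, B X ->
  [/\ lam None None (adjoint X) = adjoint (lam None None X),
      forall n, lam (Some n) None (adjoint X) = adjoint (lam None (Some n) X) &
      forall m n, lam (Some m) (Some n) (adjoint X)
                  = adjoint (lam (Some n) (Some m) X)].

Definition kronecker (mu nu : option 'I_d) (X : H -> H) : H -> H :=
  if (mu, nu) is (Some m, Some n) then X *+ (m == n) else 0.

Definition germ (lam : germ_family) : germ_family :=
  fun mu nu X => lam mu nu X + kronecker mu nu X.

Definition degenerate_repr : germ_family :=
  fun mu nu X => if (mu, nu) is (None, None) then X else 0.

(* H (+) (H (x) C^d) is [option 'I_d -> H], [None] indexing the first summand. *)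
Definition block_apply (G : option 'I_d -> option 'I_d -> (H -> H))
  (eta : option 'I_d -> H) : option 'I_d -> H :=
  fun mu => \sum_nu G mu nu (eta nu).

(* <eta|zeta> on H (+) (H (x) C^d), linear in zeta. *)
Definition block_ip (eta zeta : option 'I_d -> H) : R[i] :=
  \sum_mu ip (zeta mu) (eta mu).

Definition cond_cp (B : set (H -> H)) (io ga : germ_family) : Prop :=
  forall (N : nat) (X : 'I_N -> (H -> H)) (eta : 'I_N -> (option 'I_d -> H)),
    (forall k, B (X k)) ->
    \sum_k block_apply (fun mu nu => io mu nu (X k)) (eta k) = 0 ->
    0 <= \sum_k \sum_l block_ip (eta k)
           (block_apply (fun mu nu => ga mu nu (adjoint (X k) \o X l)) (eta l)).

(* Guichardet picture of H (x) F.  A vector is a function of the finite subsets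
   tau of R_+ with values in H (x) (C^d)^{(x) tau}; its component at
   tau = {t_1 < ... < t_n} and the basis vector e_{i_1} (x) ... (x) e_{i_n} is
   its value at the list [:: (t_1, i_1); ...; (t_n, i_n)].  Values at lists with
   non-increasing or negative times do not matter. *)
Notation fock_fun := (seq (R * 'I_d) -> H).

Fixpoint chain_sqnorm (n : nat) (a : R) (Phi : fock_fun) : \bar R :=
  if n is n'.+1 then
    (\int[@lebesgue_measure R]_(t in `[a, +oo[)
       \sum_(i < d) chain_sqnorm n' t (fun tau => Phi ((t, i) :: tau)))%E
  else (complex.Re (ip (Phi [::]) (Phi [::])))%:E.

(* The integral of |Phi(tau)|^2 over all finite subsets tau of R_+. *)
Definition fock_sqnorm (Phi : fock_fun) : \bar R :=
  (\sum_(0 <= n <oo) chain_sqnorm n 0%R Phi)%E.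

Definition fock_eq (Phi Psi : fock_fun) : Prop := fock_sqnorm (Phi - Psi) = 0%E.

(* xi (x) f^(x) *)
Definition exp_vector (xi : H) (f : noise R d) : fock_fun :=
  fun tau => (\prod_(p <- tau) f p.1 p.2) *: xi.

Definition exp_domain (Phi : fock_fun) : Prop :=
  exists s : seq (H * noise R d), (forall p, p \in s -> noiseL2 p.2) /\
    Phi = \sum_(p <- s) exp_vector p.1 p.2.

Record sesquilinear_form (S : fock_fun -> fock_fun -> R[i]) : Prop := {
  sesq_right : forall (a : R[i]) Phi Psi Psi',
    exp_domain Phi -> exp_domain Psi -> exp_domain Psi' ->
    S Phi (a *: Psi + Psi') = a * S Phi Psi + S Phi Psi';
  sesq_left : forall (a : R[i]) Phi Phi' Psi,
    exp_domain Phi -> exp_domain Phi' -> exp_domain Psi ->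
    S (a *: Phi + Phi') Psi = a^* * S Phi Psi + S Phi' Psi;
  sesq_eq : forall Phi Phi' Psi Psi',
    exp_domain Phi -> exp_domain Phi' -> exp_domain Psi -> exp_domain Psi' ->
    fock_eq Phi Phi' -> fock_eq Psi Psi' -> S Phi Psi = S Phi' Psi' }.

Notation process := (R -> (H -> H) -> fock_fun -> fock_fun -> R[i]).

(* <eta|phi_t(f,X,h) eta'> *)
Definition hform (phi : process) (t : R) (f : noise R d) (X : H -> H)
    (h : noise R d) (eta eta' : H) : R[i] :=
  phi t X (exp_vector eta f) (exp_vector eta' h)
  * cexp (- cintegral `[t, +oo[ (noise_dot f h)).

Definition adapted (B : set (H -> H)) (phi : process) : Prop :=
  forall t X (f f' h h' : noise R d) eta eta', 0 <= t -> B X ->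
    noiseL2 f -> noiseL2 f' -> noiseL2 h -> noiseL2 h' ->
    eq_before t f f' -> eq_before t h h' ->
    hform phi t f X h eta eta' = hform phi t f' X h' eta eta'.

Definition qse_rhs (lam : germ_family) (phi : process) (f : noise R d)
    (X : H -> H) (h : noise R d) (eta eta' : H) (s : R) : R[i] :=
  noise_dot f h s * hform phi s f X h eta eta'
  + hform phi s f (lam None None X) h eta eta'
  + \sum_(m < d) (f s m)^* * hform phi s f (lam (Some m) None X) h eta eta'
  + \sum_(n < d) h s n * hform phi s f (lam None (Some n) X) h eta eta'
  + \sum_(m < d) \sum_(n < d) (f s m)^* * h s n
      * hform phi s f (lam (Some m) (Some n) X) h eta eta'.

Record qse_solution (B : set (H -> H)) (lam : germ_family) (phi : process)
    : Prop := {
  qse_form : forall t X, 0 <= t -> B X -> sesquilinear_form (phi t X);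
  qse_linear : forall t (a : R[i]) X Y Phi Psi, 0 <= t -> B X -> B Y ->
    exp_domain Phi -> exp_domain Psi ->
    phi t (a *: X + Y) Phi Psi = a * phi t X Phi Psi + phi t Y Phi Psi;
  qse_adapted : adapted B phi;
  qse_init : forall X f h eta eta', B X -> noiseL2 f -> noiseL2 h ->
    hform phi 0 f X h eta eta' = ip (X eta') eta;
  qse_evolution : forall t X f h eta eta',
    0 <= t -> B X -> noiseL2 f -> noiseL2 h ->
    cintegrable `[0, t] (qse_rhs lam phi f X h eta eta') /\
    hform phi t f X h eta eta' =
      hform phi 0 f X h eta eta'
      + cintegral `[0, t] (qse_rhs lam phi f X h eta eta') }.

(* Finitely supported families xi_X^f: [sX] and [sf] are duplicate-free lists
   containing the supports in X and in f. *)
Definition completely_positive (B : set (H -> H)) (phi : process) (t : R)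
    : Prop :=
  forall (sX : seq (H -> H)) (sf : seq (noise R d))
         (xi : (H -> H) -> noise R d -> H),
    uniq sX -> uniq sf ->
    (forall X, X \in sX -> B X) -> (forall f, f \in sf -> noiseL2 f) ->
    0 <= \sum_(X <- sX) \sum_(Z <- sX) \sum_(f <- sf) \sum_(h <- sf)
           hform phi t f (adjoint X \o Z) h (xi X f) (xi Z h).

End Operators.

(* Main.v *)
Require Import Defs.
From mathcomp Require Import all_boot all_order all_algebra sesquilinear.
From mathcomp Require Import complex.
From mathcomp Require Import all_classical all_reals all_analysis.
Set Implicit Arguments.
Unset Strict Implicit.
Unset Printing Implicit Defensive.
Import Order.TTheory GRing.Theory Num.Theory.
Import numFieldNormedType.Exports.
Local Open Scope classical_set_scope.
Local Open Scope complex_scope.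
Local Open Scope ring_scope.

(** Let F(t) be the sum of <xi_i|phi_t(f_i, X_i^* X_j, f_j) xi_j> over a finite
    family of operators X_i in B, test functions f_i and vectors xi_i.  Complete
    positivity makes F nonnegative for t > 0, and F(0) is the squared norm of
    the sum of the vectors X_i xi_i.  If that sum vanishes, then F(0) = 0, so
    F(t) / t is nonnegative and its limit as t decreases to 0 is nonnegative as
    well.

    Take for the f_i functions that are constant on [0, 1], with value
    c_i in C^d there.  On [0, 1] the equation says that the derivative of
    phi_t(f_i, X, f_j) is phi_t(f_i, Y, f_j), where Y is the combination of the
    germs gamma^mu_nu(X) with coefficients conj(c_i^mu) c_j^nu, and c^mu is read
    as 1 when mu is the first index ([qse_rhs_step]; the term f^* h in the
    equation is the Kronecker delta in the germ).  The limit of F(t) / t is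
    therefore the germ form evaluated at the block vectors with components
    c_i^mu xi_i ([hform_right_derivative]).

    It remains to reach an arbitrary block vector eta_k with such product
    vectors.  The values c = 0, e_1, ..., e_d suffice: eta_k is the sum of the
    eta_k^m (x) (1, e_m) and of (eta_k^- - eta_k^1 - ... - eta_k^d) (x) (1, 0)
    ([sum_split_vector]).  Its first component is then the sum of the vectors
    attached to the index k, so the hypothesis that the sum of iota(B_k) eta_k
    is zero is exactly F(0) = 0. *)

(** * Right limits at 0 of complex-valued functions *)

Section RightLimits.
Variable R : realType.
Notation mu := (@lebesgue_measure R).
Implicit Types (F G : R -> R[i]) (l m z : R[i]).

Lemma complexReM z m : complex.Re (z * m) =
  complex.Re z * complex.Re m - complex.Im z * complex.Im m.
Proof. by case: z m => a b [c e]. Qed.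

Lemma complexImM z m : complex.Im (z * m) =
  complex.Re z * complex.Im m + complex.Im z * complex.Re m.
Proof. by case: z m => a b [c e]. Qed.

(** Convergence as t decreases to 0, stated on real and imaginary parts since
    the integrals are defined componentwise. *)
Definition cvg_right0 F l : Prop :=
  complex.Re (F t) @[t --> 0^'+] --> complex.Re l /\
  complex.Im (F t) @[t --> 0^'+] --> complex.Im l.

Lemma cvg_right0_cst z : cvg_right0 (fun=> z) z.
Proof. by split; apply: cvg_cst. Qed.

Lemma cvg_right0D F G l m :
  cvg_right0 F l -> cvg_right0 G m -> cvg_right0 (fun t => F t + G t) (l + m).
Proof.
move=> [Fr Fi] [Gr Gi]; split.
- under eq_fun do rewrite raddfD.
  by rewrite raddfD; exact: cvgD.
- under eq_fun do rewrite raddfD.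
  by rewrite raddfD; exact: cvgD.
Qed.

Lemma cvg_right0M F G l m :
  cvg_right0 F l -> cvg_right0 G m -> cvg_right0 (fun t => F t * G t) (l * m).
Proof.
move=> [Fr Fi] [Gr Gi]; split.
- under eq_fun do rewrite complexReM.
  by rewrite complexReM; apply: cvgB; exact: cvgM.
- under eq_fun do rewrite complexImM.
  by rewrite complexImM; apply: cvgD; exact: cvgM.
Qed.

Lemma cvg_right0_sum (I : Type) (r : seq I) (F : I -> R -> R[i]) (l : I -> R[i]) :
  (forall i, cvg_right0 (F i) (l i)) ->
  cvg_right0 (fun t => \sum_(i <- r) F i t) (\sum_(i <- r) l i).
Proof.
move=> Fl; elim: r => [|i r IHr].
  rewrite big_nil; under eq_fun do rewrite big_nil; exact: cvg_right0_cst.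
rewrite big_cons; under eq_fun do rewrite big_cons.
by apply: cvg_right0D.
Qed.

Lemma near_eq_cvg_right0 F G l :
  (\forall t \near 0^'+, F t = G t) -> cvg_right0 F l -> cvg_right0 G l.
Proof.
move=> FG [Fr Fi]; split; [apply: cvg_trans Fr|apply: cvg_trans Fi];
  by apply: near_eq_cvg; apply: filterS FG => t ->.
Qed.

Lemma cvg_right0_ge0 F l :
  (\forall t \near 0^'+, 0 <= F t) -> cvg_right0 F l -> 0 <= l.
Proof.
move=> F0 [Fr Fi]; rewrite lecE; apply/andP; split => /=.
  apply/eqP; apply: (cvg_unique _ Fi).
    exact: Rhausdorff.
  have c0 : (0 : R) @[t --> (0 : R)^'+] --> (0 : R) by exact: cvg_cst.
  apply: cvg_trans c0; apply: near_eq_cvg.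
  by apply: filterS F0 => t; move/(@ger0_Im R) => /= ->.
apply: (cvgr_to_ge Fr).
by apply: filterS F0 => t; rewrite lecE => /andP[_].
Qed.

Lemma cvg_Rintegral_right0 (g : R -> R) (b : R) : 0 < b ->
  mu.-integrable `[0, b] (EFin \o g) ->
  \int[mu]_(s in `[0, t]) g s @[t --> 0^'+] --> 0.
Proof.
move=> b0 ig; apply: cvg_at_right_filter.
exact: (parameterized_integral_cvg_left b0 ig).
Qed.

(** The fundamental theorem of calculus at the left endpoint of an interval,
    where only right-continuity is available. *)
Lemma cvg_mean_right0 (g : R -> R) (b : R) : 0 < b ->
  mu.-integrable `[0, b] (EFin \o g) -> g s @[s --> 0^'+] --> g 0 ->
  t^-1 * \int[mu]_(s in `[0, t]) g s @[t --> 0^'+] --> g 0.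
Proof.
move=> b0 ig gc; apply/cvgrPdist_le => /= e e0.
move/cvgrPdist_le: gc => /(_ _ e0); rewrite near_withinE => -[/= r r0 gr].
near=> t.
have t0 : 0 < t by near: t; exact: nbhs_right_gt.
have tb : t < b by near: t; exact: nbhs_right_lt.
have tr : t < r by near: t; exact: nbhs_right_lt.
have mt : measurable (`[0, t] : set R) by [].
have igt : mu.-integrable `[0, t] (EFin \o g).
  apply: integrableS ig => //.
  by apply: subset_itvl; rewrite bnd_simp ltW.
have icst c : mu.-integrable `[0, t] (EFin \o cst (c : R)).
  apply: continuous_compact_integrable; first exact: segment_compact.
  by apply: continuous_subspaceT => ?; exact: cvg_cst.
have int_cst c : \int[mu]_(s in `[0, t]) c = c * t.
  by rewrite Rintegral_cst//= lebesgue_measure_itv/= lte_fin t0 sube0.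
have -> : g 0 = t^-1 * (\int[mu]_(s in `[0, t]) g 0).
  by rewrite int_cst mulrCA mulVf ?mulr1 ?gt_eqF.
rewrite -mulrBr -RintegralB//; last exact: icst.
rewrite normrM normfV (gtr0_norm t0) mulrC ler_pdivrMr//.
have igB : mu.-integrable `[0, t] (EFin \o (fun s => g 0 - g s)).
  rewrite (_ : EFin \o _ = (EFin \o cst (g 0)%R) \- (EFin \o g))%E.
    by apply: integrableB => //; exact: icst.
  by apply/funext => s /=; rewrite EFinB.
apply: le_trans; first by apply: le_normr_Rintegral.
rewrite -int_cst; apply: le_Rintegral => //.
- by have := integrable_norm igB.
- exact: icst.
move=> s /=; rewrite in_itv/= => /andP[]; rewrite le_eqVlt => /predU1P[<- _|s0 st].
  by rewrite subrr normr0 ltW.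
apply: gr => //=.
by rewrite sub0r normrN gtr0_norm// (le_lt_trans st).
Unshelve. all: by end_near. Qed.

Lemma cvg_cintegral_right0 F (b : R) : 0 < b -> cintegrable `[0, b] F ->
  cvg_right0 (fun t => cintegral `[0, t] F) 0.
Proof. by move=> b0 [Fr Fi]; split; apply: cvg_Rintegral_right0; eassumption. Qed.

Lemma cvg_cmean_right0 F (b : R) : 0 < b -> cintegrable `[0, b] F ->
  cvg_right0 F (F 0) ->
  cvg_right0 (fun t => (t^-1)%:C * cintegral `[0, t] F) (F 0).
Proof.
move=> b0 [Fr Fi] [Fcr Fci]; split.
- under eq_fun do rewrite complexReM /= mul0r subr0.
  exact: cvg_mean_right0 b0 Fr Fcr.
- under eq_fun do rewrite complexImM /= mul0r addr0.
  exact: cvg_mean_right0 b0 Fi Fci.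
Qed.

End RightLimits.

(** * Test functions constant on the unit interval *)

Section StepNoise.
Variables (R : realType) (d : nat).
Notation mu := (@lebesgue_measure R).
Implicit Types c : 'I_d -> R[i].

Definition step_noise c : noise R d :=
  fun s n => if s \in `[0, 1] then c n else 0.

Lemma step_noiseE c s : 0 <= s <= 1 -> step_noise c s = c.
Proof. by move=> s01; apply/funext => n; rewrite /step_noise in_itv/= s01. Qed.

Lemma step_noise_L2 c : noiseL2 (step_noise c).
Proof.
have icst (k : R) : mu.-integrable `[0, +oo[
    (fun t => (if t \in `[0, 1] then k else 0)%:E).
  have : mu.-integrable `[0, +oo[ ((EFin \o cst k) \_ (`[0, 1] : set R)).
    apply/integrable_restrict => //; rewrite setIidr; last first.
      by apply: subset_itvl; rewrite bnd_simp.
    apply: continuous_compact_integrable; first exact: segment_compact.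
    by apply: continuous_subspaceT => ?; exact: cvg_cst.
  apply: eq_integrable => // t _; rewrite patchE mem_setE /=.
  by case: ifP.
have mcst (k : R) : measurable_fun (`[0, +oo[ : set R)
    (fun t => if t \in `[0, 1] then k else 0).
  by have /measurable_int/measurable_realfun.measurable_EFinP := icst k.
move=> n; split.
- apply: eq_measurable_fun (mcst (complex.Re (c n))) => t _.
  by rewrite /step_noise; case: ifP.
- apply: eq_measurable_fun (mcst (complex.Im (c n))) => t _.
  by rewrite /step_noise; case: ifP.
- apply: eq_integrable (icst (complex.Re (c n) ^+ 2 + complex.Im (c n) ^+ 2)).
    by [].
  move=> t _; rewrite /step_noise; case: ifP => //= _.
  by rewrite expr0n addr0.
Qed.

(** The vector (1, c) of C (+) C^d through which the values of a test function
    enter the equation. *)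
Definition amplitude c : option 'I_d -> R[i] := oapp c 1.

End StepNoise.

(** * Finite sums *)

Lemma big_option (V : nmodType) (T : finType) (F : option T -> V) :
  \sum_mu F mu = F None + \sum_i F (Some i).
Proof.
rewrite (bigD1 None)//=; congr (_ + _).
rewrite (reindex_omap Some id) /=; last by case.
by apply: eq_bigl => i; rewrite eqxx.
Qed.

Lemma sum_fibres (V : nmodType) (I : finType) (S T : eqType) (p : I -> S)
    (q : I -> T) (F : I -> V) :
  \sum_(a <- undup (codom p)) \sum_(b <- undup (codom q))
     \sum_(i | (p i == a) && (q i == b)) F i = \sum_i F i.
Proof.
have fibre (U : eqType) (g : I -> U) (G : I -> V) (P : pred I) :
    \sum_(a <- undup (codom g)) \sum_(i | P i && (g i == a)) G i
    = \sum_(i | P i) G i.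
  rewrite (exchange_big_dep P) /=; last by move=> a i _ /andP[].
  apply: eq_bigr => i Pi; rewrite (big_rem (g i)) /=; last first.
    by rewrite mem_undup codom_f.
  rewrite Pi eqxx big_seq_cond big1 ?addr0// => a.
  rewrite mem_rem_uniq ?undup_uniq// inE => /andP[/andP[gia _] /eqP E].
  by rewrite E eqxx in gia.
transitivity (\sum_(a <- undup (codom p)) \sum_(i | p i == a) F i).
  by apply: eq_bigr => a _; exact: fibre.
exact: (fibre _ p F xpredT).
Qed.

(** * Adjoints and linearity in the operator algebra *)

Section HermitianForm.
Variables (R : realType) (H : completeNormedModType R[i]).
Variable ip : {dot H for Num.conj}.
Implicit Types x y z : H.

Lemma ipZl a x y : ip (a *: x) y = a * ip x y.
Proof. exact: linearZl_LR. Qed.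

Lemma ipZr a x y : ip x (a *: y) = a^* * ip x y.
Proof. exact: linearZr_LR. Qed.

Lemma ipC x y : ip x y = (ip y x)^*.
Proof. by rewrite hermC expr0 mul1r. Qed.

Lemma adjoint_unique X Y Y' : is_adjoint ip X Y -> is_adjoint ip X Y' -> Y = Y'.
Proof.
move=> XY XY'; apply/funext => x; apply/eqP; rewrite -subr_eq0.
apply/negPn/negP => /(neq0_dnorm_gt0 (s := ip)).
by rewrite {1}linearBr /= -XY -XY' subrr ltxx.
Qed.

Variable (B : set (H -> H)) (hB : unital_dagger_algebra ip B).

Lemma adjointP X : B X -> B (adjoint ip X) /\ is_adjoint ip X (adjoint ip X).
Proof.
move=> /(uda_adjoint hB)[Y BY XY].
suff -> : adjoint ip X = Y by [].
apply: (adjoint_unique _ XY).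
by apply: (@xgetPex _ 0 [set Y | is_adjoint ip X Y]); exists Y.
Qed.

Lemma uda_linear X : B X -> linear X.
Proof. by move=> /(uda_bounded hB)[]. Qed.

Lemma uda_sum X (I : Type) (r : seq I) (a : I -> R[i]) (x : I -> H) : B X ->
  X (\sum_(i <- r) a i *: x i) = \sum_(i <- r) a i *: X (x i).
Proof.
move=> BX; have X0 : X 0 = 0.
  have := uda_linear BX (-1) 0 0.
  by rewrite scaler0 addr0 scaleN1r addNr.
elim: r => [|i r IHr]; first by rewrite !big_nil.
by rewrite !big_cons uda_linear// IHr.
Qed.

End HermitianForm.

(** * The right derivative of the solution at 0 *)

Section Solution.
Variables (R : realType) (H : completeNormedModType R[i]).
Variable ip : {dot H for Num.conj}.
Variable (B : set (H -> H)) (hB : unital_dagger_algebra ip B).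
Variable d : nat.
Variable lam : option 'I_d -> option 'I_d -> (H -> H) -> (H -> H).
Hypothesis hlam : linear_maps_on B lam.
Variable phi : R -> (H -> H) -> (seq (R * 'I_d) -> H) ->
  (seq (R * 'I_d) -> H) -> R[i].
Hypothesis hphi : qse_solution ip B lam phi.
Implicit Types (f h : noise R d) (x y : H) (X Y : H -> H) (c : 'I_d -> R[i]).

Lemma uda0 : B 0.
Proof. by have := uda_scale hB 0 (uda_one hB); rewrite scale0r. Qed.

Lemma germ_closed mu nu X : B X -> B (germ lam mu nu X).
Proof.
move=> BX; apply: (uda_add hB); first exact: (hlam mu nu).1.
rewrite /kronecker; case: mu nu => [m|] [n|]; try exact: uda0.
by case: eqP => _; [rewrite mulr1n|rewrite mulr0n; exact: uda0].
Qed.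

Lemma exp_vectorD x y f : exp_vector (x + y) f = exp_vector x f + exp_vector y f.
Proof. by apply/funext => tau; rewrite /exp_vector scalerDr. Qed.

Lemma exp_vector_domain x f : noiseL2 f -> exp_domain (exp_vector x f).
Proof.
move=> fL2; exists [:: (x, f)]; split; last by rewrite big_seq1.
by move=> p; rewrite inE => /eqP ->.
Qed.

Section Additivity.
Variables (t : R) (f h : noise R d) (X : H -> H).
Hypotheses (t0 : 0 <= t) (BX : B X) (fL2 : noiseL2 f) (hL2 : noiseL2 h).

Lemma hformDr x y z :
  hform phi t f X h x (y + z) = hform phi t f X h x y + hform phi t f X h x z.
Proof.
have S := qse_form hphi t0 BX.
rewrite /hform exp_vectorD -[exp_vector y h]scale1r (sesq_right S);
  do ?exact: exp_vector_domain.
by rewrite scale1r mul1r mulrDl.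
Qed.

Lemma hformDl x y z :
  hform phi t f X h (x + y) z = hform phi t f X h x z + hform phi t f X h y z.
Proof.
have S := qse_form hphi t0 BX.
rewrite /hform exp_vectorD -[exp_vector x f]scale1r (sesq_left S);
  do ?exact: exp_vector_domain.
by rewrite scale1r conjC1 mul1r mulrDl.
Qed.

Lemma hform_sumr (I : Type) (r : seq I) (P : pred I) x (y : I -> H) :
  hform phi t f X h x (\sum_(i <- r | P i) y i) =
  \sum_(i <- r | P i) hform phi t f X h x (y i).
Proof.
apply: (big_morph _ (hformDr x)).
by apply: (addrI (hform phi t f X h x 0)); rewrite -hformDr !addr0.
Qed.

Lemma hform_suml (I : Type) (r : seq I) (P : pred I) (x : I -> H) y :
  hform phi t f X h (\sum_(i <- r | P i) x i) y =
  \sum_(i <- r | P i) hform phi t f X h (x i) y.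
Proof.
apply: (big_morph (fun x => hform phi t f X h x y) (fun x z => hformDl x z y)).
by apply: (addrI (hform phi t f X h 0 y)); rewrite -hformDl !addr0.
Qed.

Lemma hformD x y Y : B Y ->
  hform phi t f (X + Y) h x y = hform phi t f X h x y + hform phi t f Y h x y.
Proof.
move=> BY; rewrite /hform -[X]scale1r (qse_linear hphi) //;
  do ?exact: exp_vector_domain.
by rewrite scale1r mul1r mulrDl.
Qed.

End Additivity.

(** Complete positivity quantifies over duplicate-free lists of operators and of
    test functions; here both may repeat along an indexed family, the vectors
    with the same operator and test function being added up. *)
Lemma cp_family t (I : finType) (X : I -> H -> H) (f : I -> noise R d)
    (x : I -> H) : 0 <= t -> completely_positive ip B phi t ->
  (forall i, B (X i)) -> (forall i, noiseL2 (f i)) ->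
  0 <= \sum_i \sum_j hform phi t (f i) (adjoint ip (X i) \o X j) (f j) (x i) (x j).
Proof.
move=> t0 cp BX fL2.
have codomP (T : eqType) (g : I -> T) (P : T -> Prop) :
    (forall i, P (g i)) -> forall a, a \in undup (codom g) -> P a.
  by move=> Pg a; rewrite mem_undup => /codomP[i ->].
have BXs := codomP _ X B BX; have fs := codomP _ f _ fL2.
have := cp _ _ (fun Y g => \sum_(i | (X i == Y) && (f i == g)) x i)
  (undup_uniq _) (undup_uniq _) BXs fs.
congr (0 <= _).
rewrite -[RHS](sum_fibres X f).
apply: eq_big_seq => Y Ys; rewrite exchange_big /=.
apply: eq_big_seq => g gs.
transitivity (\sum_(Z <- undup (codom X)) \sum_(h <- undup (codom f))
   \sum_(i | (X i == Y) && (f i == g)) \sum_(j | (X j == Z) && (f j == h))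
   hform phi t (f i) (adjoint ip (X i) \o X j) (f j) (x i) (x j)).
  apply: eq_big_seq => Z Zs; apply: eq_big_seq => h hs.
  have BYZ : B (adjoint ip Y \o Z).
    exact: (uda_comp hB (adjointP hB (BXs _ Ys)).1 (BXs _ Zs)).
  rewrite hform_suml //; do ?exact: fs.
  apply: eq_bigr => i /andP[/eqP -> /eqP ->].
  rewrite hform_sumr //; do ?exact: fs.
  by apply: eq_bigr => j /andP[/eqP -> /eqP ->].
under [LHS]eq_bigr => Z _ do rewrite exchange_big /=.
rewrite exchange_big /=; apply: eq_bigr => i _.
exact: sum_fibres.
Qed.

(** The five terms of the equation form a single block: the first one, with
    coefficient f^* h, turns the maps lambda^m_n into the germs. *)
Lemma qse_rhs_step c c' X x y s : 0 <= s <= 1 -> B X ->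
  qse_rhs lam phi (step_noise c) X (step_noise c') x y s =
  \sum_mu \sum_nu (amplitude c mu)^* * amplitude c' nu *
    hform phi s (step_noise c) (germ lam mu nu X) (step_noise c') x y.
Proof.
move=> s01 BX; have /andP[s0 _] := s01.
rewrite /qse_rhs /noise_dot !step_noiseE//.
pose F Y := hform phi s (step_noise c) Y (step_noise c') x y.
rewrite -!/(F _).
have germN mu : germ lam mu None X = lam mu None X.
  by rewrite /germ; case: mu => [m|] /=; rewrite addr0.
have germN' nu : germ lam None nu X = lam None nu X.
  by rewrite /germ; case: nu => [m|] /=; rewrite addr0.
have germS m n : F (germ lam (Some m) (Some n) X) =
    F (lam (Some m) (Some n) X) + F X *+ (m == n).
  rewrite /germ /kronecker /=; case: eqP => _.
    by rewrite mulr1n /F hformD//; [exact: (hlam _ _).1|exact: step_noise_L2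
      |exact: step_noise_L2].
  by rewrite !mulr0n !addr0.
rewrite big_option big_option /= conjC1 !mul1r germN -/(F _).
rewrite [X in _ = _ + X](_ : _ = \sum_m (c m)^* * F (lam (Some m) None X)
    + (\sum_m \sum_n (c m)^* * c' n * F (lam (Some m) (Some n) X)
    + (\sum_n (c n)^* * c' n) * F X)); last first.
  rewrite mulr_suml -!big_split /=; apply: eq_bigr => m _.
  rewrite big_option /= mulr1 germN -/(F _); congr (_ + _).
  under eq_bigr => n _ do rewrite -/(F _) germS mulrDr.
  rewrite big_split /=; congr (_ + _).
  rewrite (bigD1 m)//= eqxx mulr1n big1 ?addr0// => n /negbTE nm.
  by rewrite eq_sym nm mulr0n mulr0.
under [\sum_n _ * hform _ _ _ (germ _ _ _ _) _ _ _]eq_bigr => n _ do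
  rewrite mul1r germN' -/(F _).
rewrite !addrA [RHS]addrC !addrA; congr (_ + _); exact: addrAC.
Qed.

(** The derivative of the solution at t = 0, obtained by bootstrapping: the
    integrated equation makes every [hform] right-continuous at 0, hence so is
    its right-hand side, whose mean over [0, t] then tends to its value at 0. *)
Lemma hform_right_derivative c c' X x y : B X ->
  cvg_right0 (fun t => (t^-1)%:C *
      (hform phi t (step_noise c) X (step_noise c') x y - ip (X y) x))
    (\sum_mu \sum_nu (amplitude c mu)^* * amplitude c' nu *
       ip (germ lam mu nu X y) x).
Proof.
move=> BX.
set f := step_noise c; set h := step_noise c'.
have fL2 : noiseL2 f := step_noise_L2 c.
have hL2 : noiseL2 h := step_noise_L2 c'.
have evol Y t : B Y -> 0 <= t ->
    hform phi t f Y h x y = ip (Y y) x +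
      cintegral `[0, t] (qse_rhs lam phi f Y h x y).
  move=> BY t0; rewrite -(qse_init hphi x y BY fL2 hL2).
  exact: (qse_evolution hphi x y t0 BY fL2 hL2).2.
have int1 Y : B Y -> cintegrable `[0, 1] (qse_rhs lam phi f Y h x y).
  by move=> BY; exact: (qse_evolution hphi x y ler01 BY fL2 hL2).1.
have cont Y : B Y -> cvg_right0 (fun t => hform phi t f Y h x y) (ip (Y y) x).
  move=> BY; have := cvg_right0D (cvg_right0_cst (ip (Y y) x))
    (cvg_cintegral_right0 ltr01 (int1 _ BY)).
  rewrite addr0; apply: near_eq_cvg_right0.
  by apply: filterS (nbhs_right_gt 0) => t /ltW t0; rewrite evol.
have rhs0 : qse_rhs lam phi f X h x y 0 = \sum_mu \sum_nu
    (amplitude c mu)^* * amplitude c' nu * ip (germ lam mu nu X y) x.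
  rewrite qse_rhs_step ?lexx ?ler01//; apply: eq_bigr => mu _.
  apply: eq_bigr => nu _; rewrite (qse_init hphi) //.
  exact: germ_closed.
rewrite -rhs0.
have := cvg_cmean_right0 ltr01 (int1 _ BX).
have rhs_cont : cvg_right0 (qse_rhs lam phi f X h x y)
    (qse_rhs lam phi f X h x y 0).
  rewrite rhs0.
  apply: near_eq_cvg_right0 (cvg_right0_sum _ _) => //=; last first.
    move=> mu; apply: cvg_right0_sum => nu.
    apply: cvg_right0M; first exact: cvg_right0_cst.
    by apply: cont; exact: germ_closed.
  near=> s; rewrite -qse_rhs_step//; apply/andP; split.
    by near: s; exact: nbhs_right_ge.
  by near: s; exact: nbhs_right_le.
move=> /(_ rhs_cont); apply: near_eq_cvg_right0.
apply: filterS (nbhs_right_gt 0) => t /ltW t0.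
by rewrite evol// addrAC subrr add0r.
Unshelve. all: by end_near. Qed.

End Solution.

(** * Decomposition of block vectors and conclusion *)

Section UnitAmplitudes.
Variables (R : realType) (H : lmodType R[i]) (d : nat).

Definition unit_amplitude (a : option 'I_d) : 'I_d -> R[i] :=
  fun n => (a == Some n)%:R.

(** The vectors to be attached to the values e_m (for [Some m]) and 0 (for
    [None]) of the test function; the latter compensates in the first component
    for all the others. *)
Definition split_vector (eta : option 'I_d -> H) (a : option 'I_d) : H :=
  if a is None then eta None - \sum_m eta (Some m) else eta a.

Lemma sum_split_vector (eta : option 'I_d -> H) mu :
  \sum_a amplitude (unit_amplitude a) mu *: split_vector eta a = eta mu.
Proof.
rewrite big_option; case: mu => [m|] /=.
  rewrite scale0r add0r (bigD1 m)//= /unit_amplitude eqxx scale1r big1 ?addr0//.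
  by move=> n nm; rewrite (inj_eq Some_inj) (negbTE nm) scale0r.
by rewrite -scaler_sumr !scale1r subrK.
Qed.

End UnitAmplitudes.

(** The germ form at arbitrary block vectors in terms of its values at product
    vectors, by sesquilinearity. *)
Lemma block_ip_split (R : realType) (H : completeNormedModType R[i])
    (ip : {dot H for Num.conj}) (B : set (H -> H))
    (hB : unital_dagger_algebra ip B) (d : nat)
    (G : option 'I_d -> option 'I_d -> H -> H) (eta zeta : option 'I_d -> H) :
  (forall mu nu, B (G mu nu)) ->
  block_ip ip eta (block_apply G zeta) =
  \sum_a \sum_b \sum_mu \sum_nu
    (amplitude (unit_amplitude R a) mu)^* * amplitude (unit_amplitude R b) nu *
    ip (G mu nu (split_vector zeta b)) (split_vector eta a).
Proof.
move=> BG; under [RHS]eq_bigr => a _ do rewrite exchange_big.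
rewrite exchange_big; apply: eq_bigr => mu _ /=.
rewrite -[in LHS](sum_split_vector eta mu) linear_sumr; apply: eq_bigr => a _ /=.
rewrite ipZr /block_apply linear_sumlz mulr_sumr exchange_big.
apply: eq_bigr => nu _ /=.
rewrite -[in LHS](sum_split_vector zeta nu) (uda_sum hB)// linear_sumlz mulr_sumr.
by apply: eq_bigr => b _; rewrite /= ipZl mulrA.
Qed.

Theorem theorem1 (R : realType) (H : completeNormedModType R[i])
    (ip : {dot H for Num.conj}) (hip : hilbert_product ip) (d : nat)
    (B : set (H -> H)) (hB : unital_dagger_algebra ip B)
    (lam : option 'I_d -> option 'I_d -> (H -> H) -> (H -> H))
    (hlam : linear_maps_on B lam) (hflat : flat_property ip B lam)
    (hsol : exists phi, qse_solution ip B lam phi /\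
       forall t : R, 0 < t -> completely_positive ip B phi t) :
  cond_cp ip B (@degenerate_repr R H d) (germ lam).
Proof.
have [phi [hphi cp]] := hsol.
move=> N X eta BX Xeta0.
pose x (i : 'I_N * option 'I_d) : H := split_vector (eta i.1) i.2.
pose c (i : 'I_N * option 'I_d) := unit_amplitude R i.2.
pose A k l := adjoint ip (X k) \o X l.
have BA k l : B (A k l).
  exact: (uda_comp hB (adjointP hB (BX k)).1 (BX l)).
(* The vectors attached to k add up to the first component of [eta k]. *)
have sumX : \sum_i X i.1 (x i) = 0.
  transitivity ((0 : option 'I_d -> H) None) => //.
  rewrite -Xeta0 fct_sumE.
  rewrite -(pair_bigA _ (fun k a => X k (x (k, a)))).
  apply: eq_bigr => k _.
  rewrite /block_apply [RHS]big_option [X in _ = _ + X]big1 ?addr0//=.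
  rewrite -(sum_split_vector (eta k) None) (uda_sum hB)//=.
    by apply: eq_bigr => a _; rewrite scale1r.
  exact: BX.
(* At t = 0 the positive form is the squared norm of the sum in [sumX]. *)
have init0 : \sum_i \sum_j ip (A i.1 j.1 (x j)) (x i) = 0.
  transitivity (ip (\sum_j X j.1 (x j)) (\sum_i X i.1 (x i))); last first.
    by rewrite sumX linear0l.
  rewrite linear_sumr /=; apply: eq_bigr => i _.
  rewrite linear_sumlz /=; apply: eq_bigr => j _.
  by rewrite ipC -(adjointP hB (BX i.1)).2 -ipC.
pose T i j := \sum_mu \sum_nu (amplitude (c i) mu)^* * amplitude (c j) nu *
  ip (germ lam mu nu (A i.1 j.1) (x j)) (x i).
have -> : \sum_k \sum_l block_ip ip (eta k)
    (block_apply (fun mu nu => germ lam mu nu (A k l)) (eta l)) =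
    \sum_i \sum_j T i j.
  rewrite -(pair_bigA _ (fun k a => \sum_j T (k, a) j)); apply: eq_bigr => k _.
  under [RHS]eq_bigr => a _ do rewrite -(pair_bigA _ (fun l b => T (k, a) (l, b))).
  rewrite [RHS]exchange_big; apply: eq_bigr => l _ /=.
  by apply: (block_ip_split hB) => mu nu; exact: (germ_closed hB hlam).
have := cvg_right0_sum (index_enum _) (fun i => cvg_right0_sum (index_enum _)
  (fun j => hform_right_derivative hB hlam hphi (c i) (c j) (x i) (x j)
     (BA i.1 j.1))).
apply: cvg_right0_ge0.
apply: filterS (nbhs_right_gt 0) => t t0.
under eq_bigr => i _ do rewrite -mulr_sumr.
rewrite -mulr_sumr mulr_ge0//.
  by rewrite lecR invr_ge0 ltW.
under eq_bigr => i _ do rewrite sumrB.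
rewrite sumrB init0 subr0.
apply: (cp_family hB hphi (X := fun i => X i.1) (f := fun i => step_noise (c i))
  x (ltW t0) (cp t t0)) => i; [exact: BX | exact: step_noise_L2].
Qed.
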